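(* There are absolute positive constants $c_1,c_2$ such that the following holds for every finite commutative group $G$ with $|G|=q$. (a) If $q^{-1/2}<\rho<1-q^{-1/3}\log q$, then with probability exceeding $1-\exp\left(-c_1\log^2 q/\log\frac1\rho\right)$ the random standard set $R$ corresponding to probability $\rho$ satisfies \[ \overline\Delta(R)<c_2\left(\frac{\log q}{\log\frac1\rho}\right)^2,\qquad \overline\delta(R)>\frac{1}{c_2}\left(\frac{\log\frac1\rho}{\log q}\right)^2. \] If $1-q^{-1/3}\log q<\rho<1-16c\frac{\log q}{q}$ with $1<c<\frac{q}{32\log q}$, then with probability exceeding $1-2q^{1-c}$ we have \[ \overline\Delta(R)<3\sqrt{c\log q}\sqrt{\frac{\rho q}{1-\rho}},\qquad \overline\delta(R)>\frac{1}{3\sqrt{c\log q}}\sqrt{\frac{1-\rho}{\rho q}}. \] (b) If $q^{-1/3}\log q<\rho<1-q^{-1/2}$, then with probability exceeding $1-\exp\left(-c_1\log^2 q/\log\frac1{1-\rho}\right)$ the random standard set $R$ corresponding to probability $\rho$ satisfies \[ \Delta(R)<c_2\left(\frac{\log q}{\log\frac1{1-\rho}}\right)^2,\qquad \delta(R)<\frac{c_2}{q}\left(\frac{\log q}{\log\frac1{1-\rho}}\right)^2. \] If $16c\frac{\log q}{q}<\rho<q^{-1/3}\log q$ with $1<c<\frac{q}{32\log q}$, then with probability exceeding $1-2q^{1-c}$ we have \[ \Delta(R)<3\sqrt{c\log q}\sqrt{\frac{(1-\rho)q}{\rho}},\qquad \delta(R)<3\sqrt{c\log q}\sqrt{\frac{1-\rho}{\rho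 q}}. \]
   Context: $G$ is written additively; $\log$ is the natural logarithm. A set $A\subset G$ is a standard set if $A=-A$ and $0\in A$. For a standard set $A$: $\Delta(A)=\max\{|B|:B\subset G,\ (B-B)\cap A=\{0\}\}$, $\delta(A)=\Delta(A)/q$, $\overline\Delta(A)=\max\{|B|:B\subset G,\ B-B\subset A\}$, $\overline\delta(A)=1/\overline\Delta(A)$. Random standard set: let $G_1=\{x\in G:2x=0\}$ and let $G_2$ be a set containing exactly one element of each pair $\{x,-x\}$ partitioning $G\setminus G_1$. Let $\{\xi_y:y\in G_1\cup G_2\}$ be independent $\{0,1\}$-valued random variables with $\Pr(\xi_y=1)=\rho$. The random standard set corresponding to probability $\rho$ is $R=\{0\}\cup\{y\in G_1:\xi_y=1\}\cup\bigcup_{y\in G_2,\ \xi_y=1}\{y,-y\}$. *)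

(* Defs.v *)
From HB Require Import structures.
From mathcomp Require Import all_boot all_order all_algebra.
From mathcomp Require Import all_classical all_reals all_analysis.

Set Implicit Arguments.
Unset Strict Implicit.
Unset Printing Implicit Defensive.

Import Order.TTheory GRing.Theory Num.Theory.

Local Open Scope ring_scope.

Section StandardSets.
Variable G : finZmodType.
Implicit Types A B : {set G}.

Definition standard_set A : Prop :=
  A = [set - x | x in A]%SET /\ 0 \in A.

Definition diffset B : {set G} := [set x - y | x in B, y in B]%SET.

Definition Delta A : nat :=
  \max_(B : {set G} | diffset B :&: A == [set 0]%SET) #|B|.

Definition Deltabar A : nat :=
  \max_(B : {set G} | diffset B \subset A) #|B|.

Definition delta (R : realType) A : R := (Delta A)%:R / #|G|%:R.

Definition deltabar (R : realType) A : R := (Deltabar A)%:R^-1.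

Definition two_torsion : {set G} := [set x | x *+ 2 == 0]%SET.

(* The choice of one element from each pair {x, -x} partitioning the complement
   of the 2-torsion [two_torsion]. *)
Definition half_system (G2 : {set G}) : Prop :=
  G2 \subset ~: two_torsion /\
  forall x : G, x \notin two_torsion ->
    #|([set x; - x] :&: G2)%SET| = 1%N.

End StandardSets.

Arguments delta {G} R A.
Arguments deltabar {G} R A.
Arguments two_torsion : clear implicits.

Section RandomSets.
Context (d : measure_display) (T : measurableType d) (R : realType).
Variable P : probability T R.

(* Mutual independence of the random variables [X i], [i \in D]; the values of
   [X] outside [D] are unconstrained. *)
Definition mutually_independent (I : finType) (d' : measure_display)
    (T' : measurableType d') (D : {set I}) (X : I -> {RV P >-> T'}) : Prop :=
  forall J : {set I}, J \subset D ->
  forall B : I -> set T', (forall i, i \in J -> measurable (B i)) ->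
    P (\bigcap_(i in [set` J]) (X i @^-1` B i))%classic =
    (\prod_(i in J) P (X i @^-1` B i)%classic)%E.

Variable G : finZmodType.

Definition random_standard_set (G2 : {set G}) (xi : G -> {RV P >-> bool})
    (w : T) : {set G} :=
  ([set 0] :|: [set y in two_torsion G | xi y w]
    :|: \bigcup_(y in G2 | xi y w) [set y; - y])%SET.

(* [xi] is only used on [two_torsion G :|: G2]. *)
Definition bernoulli_family (rho : R) (G2 : {set G})
    (xi : G -> {RV P >-> bool}) : Prop :=
  mutually_independent (two_torsion G :|: G2) xi /\
  forall y, y \in two_torsion G :|: G2 ->
    P [set w | xi y w = true]%classic = rho%:E.

Lemma random_standard_setP (G2 : {set G}) (xi : G -> {RV P >-> bool}) (w : T) :
  standard_set (random_standard_set G2 xi w).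
Proof.
have N x : x \in random_standard_set G2 xi w ->
    - x \in random_standard_set G2 xi w.
  rewrite !inE => /orP[/orP[/eqP->|/andP[/eqP x2 xix]]|].
  - by rewrite oppr0 eqxx.
  - have -> : - x = x by apply/eqP; rewrite eq_sym -addr_eq0 -mulr2n x2.
    by rewrite x2 xix eqxx orbT.
  - move=> /bigcupP[y yP]; rewrite !inE => xy.
    apply/orP; right; apply/bigcupP; exists y => //.
    by rewrite !inE; case/orP: xy => /eqP ->; rewrite ?opprK eqxx ?orbT.
split; last by rewrite !inE eqxx.
apply/setP => x; apply/idP/imsetP => [xR|[y yR ->]]; last exact: N.
by exists (- x); [exact: N | rewrite opprK].
Qed.

End RandomSets.

(* Main.v *)
Require Import Defs.
From HB Require Import structures.
From mathcomp Require Import all_boot all_order all_algebra.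
From mathcomp Require Import fingroup cyclic separable cyclotomic.
From mathcomp Require Import all_classical all_reals all_analysis.
From mathcomp Require Import complex lra ring zify.

(** The differences of a set only matter up to sign, so "[B - B] avoids [R]" and
    "[B - B] is contained in [R]" both say that [B] is a clique of one colour in the
    Cayley colouring of [G] given by independent bits, and part (b) is part (a) with
    [rho] replaced by [1 - rho].

    In the first range, a set with at least [4 m^2] elements greedily contains a set
    [S] of size [m] with at least [3 m (m - 1) / 8] nonzero differences, and a union
    bound over the at most [q^m] such [S] with [m] of order [ln q / ln (1 / rho)]
    suffices.

    In the second range, Hoffman's bound reduces a large clique to an atypically small
    Fourier coefficient of the centred random set, which for each of the [q]
    characters has probability less than [2 q^-c] by Chernoff's inequality. *)

Set Implicit Arguments.
Unset Strict Implicit.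
Unset Printing Implicit Defensive.

Import Order.TTheory GRing.Theory Num.Theory.

Local Open Scope ring_scope.

(** * Characters of finite abelian groups *)

Lemma finZmod_mulrn_card (G : finZmodType) (x : G) : x *+ #|G| = 0.
Proof.
have := expg_cardG (finset.in_setT x); rewrite cardsT => h.
by rewrite -[RHS]h FinRing.zmodXgE.
Qed.

(* The translations of [C^G] commute and have finite order, so they are
   simultaneously diagonalizable; each diagonal position carries a character,
   and the last clause is the trace of a translation. *)
Lemma finZmod_dual (C : numClosedFieldType) (G : finZmodType) :
  exists chi : 'I_(#|G|.-1.+1) -> G -> C,
  [/\ forall j, chi j 0 = 1,
      forall j x y, chi j (x + y) = chi j x * chi j y &
      forall z, \sum_j chi j z = #|G|%:R * (z == 0)%:R].
Proof.
have G0 : (0 < #|G|)%N by apply/card_gt0P; exists 0.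
set n := #|G|.-1; have nE : n.+1 = #|G| by rewrite /n prednK.
pose e (i : 'I_n.+1) : G := enum_val (cast_ord nE i).
pose r (x : G) : 'I_n.+1 := cast_ord (esym nE) (enum_rank x).
have eK x : e (r x) = x by rewrite /e /r cast_ordKV enum_rankK.
have rK i : r (e i) = i by rewrite /e /r enum_valK cast_ordK.
pose T (x : G) : 'M[C]_n.+1 := \matrix_(i, j) (e i + x == e j)%:R.
have TM x y : T x *m T y = T (x + y).
  apply/matrixP => i j; rewrite !mxE (bigD1 (r (e i + x))) //= big1 => [|k kn].
    by rewrite !mxE eK eqxx mul1r addr0 addrA.
  rewrite !mxE; case: eqP => [E|]; last by rewrite mul0r.
  by rewrite E rK eqxx in kn.
have T0 : T 0 = 1%:M.
  apply/matrixP => i j; rewrite !mxE addr0; congr (nat_of_bool _)%:R.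
  by apply/eqP/eqP => [/(congr1 r)|->//]; rewrite !rK.
have TX x k : T x ^+ k = T (x *+ k).
  elim: k => [|k IH]; first by rewrite expr0 mulr0n T0.
  by rewrite exprS IH mulrS -TM.
have Tdiag x : diagonalizable (T x).
  have xn : x *+ n.+1 = 0 by rewrite nE finZmod_mulrn_card.
  (* [T x] is a root of ['X^(n.+1) - 1], which has distinct roots because [n.+1] is nonzero in
     [C]. *)
  apply/diagonalizableP.
  have [rs Drs] := closed_field_poly_normal ('X^(n.+1) - 1 : {poly C}).
  have lc : lead_coef ('X^(n.+1) - 1 : {poly C}) = 1.
    by apply/eqP; exact: monicXnsubC.
  rewrite lc scale1r in Drs.
  exists rs.
    rewrite -separable_prod_XsubC -Drs; apply: cyclotomic.separable_Xn_sub_1.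
    by rewrite pnatr_eq0.
  rewrite -Drs; apply: mxminpoly_min.
  by rewrite rmorphB rmorphXn /= horner_mx_X rmorph1 TX xn T0 subrr.
have [P Pu /allP PD] : codiagonalizable [seq T x | x <- enum G].
  apply/codiagonalizableP; split; last by move=> _ /mapP[x _ ->].
  by move=> _ _ /mapP[x _ ->] /mapP[y _ ->]; rewrite /comm_mx !TM addrC.
have {}PD x : exists d : 'rV_n.+1, P *m T x = diag_mx d *m P.
  have /PD /= : T x \in [seq T x | x <- enum G] by apply: map_f; rewrite mem_enum.
  by move=> /diagonalizable_forPex[d /(simmxP Pu)]; exists d.
have /choice[dd ddP] := PD.
have ddE x : diag_mx (dd x) = P *m T x *m invmx P by rewrite ddP mulmxK.
exists (fun j x => dd x 0 j); split.
- move=> j; have := congr1 (fun M : 'M[C]_n.+1 => M j j) (ddE 0).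
  by rewrite T0 mulmx1 mulmxV // !mxE eqxx mulr1n.
- move=> j x y; have : diag_mx (dd (x + y)) = diag_mx (dd x) *m diag_mx (dd y).
    by rewrite !ddE -TM !mulmxA mulmxKV.
  by move=> /(congr1 (fun M : 'M[C]_n.+1 => M j j)); rewrite mulmx_diag !mxE eqxx !mulr1n.
- move=> z; rewrite -mxtrace_diag ddE mxtrace_mulC mulKmx //.
  rewrite /mxtrace (eq_bigr (fun _ => (z == 0)%:R)) => [|i _].
    by rewrite sumr_const card_ord nE mulr_natl.
  by rewrite mxE -subr_eq0 addrAC subrr add0r.
Qed.

(* The [c j] are the real parts of the characters. *)
Lemma real_characters (R : realType) (G : finZmodType) :
  exists c : 'I_(#|G|.-1.+1) -> G -> R,
  [/\ forall j z, `|c j z| <= 1,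
      forall j z, c j (- z) = c j z,
      forall j x y, c j (x - y) + c j (x + y) = 2 * c j x * c j y,
      forall j (B : {set G}), 0 <= \sum_(x in B) \sum_(y in B) c j (x - y) &
      forall z, \sum_j c j z = #|G|%:R * (z == 0)%:R].
Proof.
have [chi [chi0 chiD chiS]] := finZmod_dual (R[i] : numClosedFieldType) G.
have chiX j x k : chi j (x *+ k) = chi j x ^+ k.
  elim: k => [|k IH]; first by rewrite mulr0n chi0 expr0.
  by rewrite mulrS chiD IH exprS.
have G0 : (0 < #|G|)%N by apply/card_gt0P; exists 0.
have chi_norm j x : `|chi j x| = 1.
  apply/eqP; rewrite -(@pexpr_eq1 _ _ #|G|) ?G0 //.
  by rewrite -normrX -chiX finZmod_mulrn_card chi0 normr1.
have chiN j x : chi j (- x) = (chi j x)^*%C.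
  have h : chi j x * (chi j x)^*%C = 1 by rewrite -sqr_normc chi_norm expr1n.
  have nz : chi j x != 0 by rewrite -normr_eq0 chi_norm oner_eq0.
  by apply: (mulfI nz); rewrite h -chiD subrr chi0.
exists (fun j z => complex.Re (chi j z)).
have ReJ (z : R[i]) : complex.Re z^*%C = complex.Re z by case: z.
have ReD (u v : R[i]) : complex.Re (u + v) = complex.Re u + complex.Re v by case: u; case: v.
have Resum (I : Type) (s : seq I) (Q : pred I) (F : I -> R[i]) :
    complex.Re (\sum_(i <- s | Q i) F i) = \sum_(i <- s | Q i) complex.Re (F i).
  by apply: (big_morph (@complex.Re R)).
split.
- move=> j z; rewrite -lecR; apply: le_trans (normc_ge_Re _) _.
  by rewrite chi_norm.
- by move=> j z; rewrite chiN ReJ.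
- move=> j x y; rewrite !chiD chiN.
  case: (chi j x) => a b; case: (chi j y) => a' b' /=; ring.
- move=> j B.
  (* The double sum is the squared modulus of the character sum over [B]. *)
  have -> : \sum_(x in B) \sum_(y in B) complex.Re (chi j (x - y)) =
      complex.Re ((\sum_(x in B) chi j x) * (\sum_(y in B) chi j y)^*%C).
    rewrite mulr_suml Resum; apply: eq_bigr => x _.
    rewrite rmorph_sum mulr_sumr Resum; apply: eq_bigr => y _.
    by rewrite chiD chiN.
  by have := mulcJ_ge0 (\sum_(x in B) chi j x); rewrite lecE => /andP[].
- move=> z; rewrite -Resum chiS.
  by case: (z == 0); rewrite ?mulr1 ?mulr0 // -(rmorph_nat (real_complex R)).
Qed.

(** * Subsets with many differences *)

Lemma card_diffset (G : finZmodType) (S : {set G}) : (#|diffset S| <= #|S| ^ 2)%N.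
Proof.
rewrite /diffset curry_imset2X; apply: leq_trans (leq_imset_card _ _) _.
by rewrite cardsX mulnn.
Qed.

(* Greedy choice: averaging over [B], some [b] has at most [#|S| / 4] differences
   [b - s] that already occur in [S - S], so adding it creates at least
   [3/4 * #|S|] new ones. *)
Lemma diffset_extend (G : finZmodType) (B S : {set G}) :
  (0 < #|S|)%N -> (4 * #|S| ^ 2 <= #|B|)%N ->
  exists2 b, b \in B :\: S &
    (3 * #|S| + 4 * #|diffset S| <= 4 * #|diffset (b |: S)|)%N.
Proof.
move=> S0 SB.
pose bad (b : G) := [set s in S | b - s \in diffset S]%SET.
have [b bB bad_b] : exists2 b, b \in B & (4 * #|bad b| <= #|S|)%N.
  (* If every [bad b] had more than [#|S| / 4] elements, then [#|B| * (#|S| + 1) <= 4 * #|S| *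
     #|diffset S| <= 4 * #|S|^3], against [#|B| >= 4 * #|S|^2]. The first bound counts pairs
     [(b, s)]: for fixed [s], [b - s] is injective in [b]. *)
  apply/exists_inP; rewrite -[X in is_true X]negbK negb_exists_in.
  apply/negP => /forall_inP h.
  have : (\sum_(b in B) #|bad b| <= #|S| * #|diffset S|)%N.
    rewrite (eq_bigr (fun b : G => \sum_(s in S) ((b - s)%R \in diffset S))%N); last first.
      by move=> b _; rewrite -sum1dep_card big_mkcondr.
    rewrite exchange_big /= -sum_nat_const; apply: leq_sum => s _.
    rewrite -big_mkcondr /= sum1dep_card -(card_imset _ (addIr (- s))).
    apply/subset_leq_card/fintype.subsetP => _ /imsetP[b + ->].
    by rewrite inE => /andP[].
  have : (#|B| * #|S|.+1 <= 4 * \sum_(b in B) #|bad b|)%N.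
    rewrite -sum_nat_const big_distrr /=; apply: leq_sum => b bB.
    by rewrite ltnNge; exact: h.
  have := card_diffset S; nia.
have bS : b \notin S.
  apply/negP => bS; have : bad b = S.
    apply/finset.setP => s; rewrite inE; case sS: (s \in S) => //=.
    by apply/imset2P; exists b s.
  by move=> E; move: bad_b; rewrite E; lia.
exists b; first by rewrite !inE bS bB.
have sub : (diffset S :|: [set b - s | s in S :\: bad b]%SET) \subset diffset (b |: S).
  rewrite finset.subUset; apply/andP; split; apply/fintype.subsetP => z.
    by move=> /imset2P[x y xS yS ->]; apply/imset2P; exists x y; rewrite // !inE ?xS ?yS orbT.
  move=> /imsetP[s]; rewrite inE => /andP[_ sS] ->.
  by apply/imset2P; exists b s; rewrite // !inE ?eqxx ?sS ?orbT.
have := subset_leq_card sub; rewrite cardsU.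
have -> : (diffset S :&: [set b - s | s in S :\: bad b] = finset.set0)%SET.
  apply/finset.setP => z; rewrite finset.in_set0 inE; apply/negP => /andP[zD /imsetP[s]].
  by rewrite !inE => /andP[+ sS] E; rewrite sS -E zD.
rewrite cards0 subn0 card_imset; last by move=> x y /addrI/oppr_inj.
have badS : bad b \subset S by apply/fintype.subsetP => s; rewrite inE => /andP[].
have := cardsD S (bad b); rewrite (finset.setIidPr badS).
have := subset_leq_card badS; move: bad_b; clear.
move: #|bad b| #|S| #|S :\: bad b| #|diffset S| #|diffset (b |: S)| => *; lia.
Qed.

(** Induction on [m]: enlarging a set of size [k] gains at least [3k/4] differences, and these gains
    for [k < m] sum to [3m(m - 1)/8]. The predecessor discounts the difference 0. *)
Lemma exists_subset_large_diffset (G : finZmodType) (B : {set G}) m :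
  (4 * m ^ 2 <= #|B|)%N ->
  exists S : {set G}, [/\ S \subset B, #|S| = m &
    (3 * (m * m.-1) <= 8 * #|diffset S|.-1)%N].
Proof.
elim: m => [|[|m] IH] mB.
- by exists finset.set0; rewrite finset.sub0set cards0.
- have /card_gt0P[b bB] : (0 < #|B|)%N by lia.
  by exists [set b]%SET; rewrite finset.sub1set bB cards1.
have [|S [SB cS dS]] := IH; first by lia.
have [||b] := @diffset_extend G B S; rewrite ?cS //; first by lia.
rewrite inE => /andP[bS bB] h; exists (b |: S); split.
- by rewrite finset.subUset finset.sub1set bB SB.
- by rewrite cardsU1 bS cS.
- have : (0 < #|diffset S|)%N.
    have /card_gt0P[s sS] : (0 < #|S|)%N by rewrite cS.
    by apply/card_gt0P; exists (s - s); apply/imset2P; exists s s.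
  move: h dS; rewrite /=; clear.
  by move: #|diffset S| #|diffset (b |: S)| => *; nia.
Qed.

(** * Numerical bounds on the exponential *)

(** After multiplication by [expR (- y)], the case [y <= 0] follows from
    [(1 - y)(1 + y + y^2) = 1 - y^3 >= 1]; for [y > 0] a sharper minorant of [expR (- y)] than
    [1 - y] is needed. *)
Lemma expR_le_quadratic (R : realType) (y : R) :
  `|y| <= 1 -> expR y <= 1 + y + y ^+ 2.
Proof.
rewrite ler_norml => /andP[y1 y2].
suff : 1 <= expR (- y) * (1 + y + y ^+ 2).
  by rewrite expRN mulrC ler_pdivlMr ?expR_gt0 // mul1r.
have [y0|y0] := leP y 0.
  apply: (@le_trans _ _ ((1 - y) * (1 + y + y ^+ 2))).
    have -> : (1 - y) * (1 + y + y ^+ 2) = 1 + (- y) * y ^+ 2 by ring.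
    by rewrite lerDl mulr_ge0 ?sqr_ge0 // oppr_ge0.
  by apply: ler_wpM2r; [have := sqr_ge0 y; lra | exact: expR_ge1Dx].
(* A quadratic minorant of [(1 - y/8)^4], whose square is at most [expR (- y)]. The coefficient
   12/128 of [y^2] is lowered to 11/128 to absorb the cubic term [- y^3/128]. *)
pose t := 1 - y / 2 + 11 / 128 * y ^+ 2.
have t0 : 0 <= t by rewrite /t; have := sqr_ge0 y; lra.
have : t ^+ 2 <= expR (- y).
  have -> : expR (- y) = (expR (- (y / 8)) ^+ 4) ^+ 2.
    by rewrite -exprM -expRM_natl; congr expR; field.
  rewrite ler_sqr ?nnegrE ?exprn_ge0 ?expR_ge0 //.
  apply: (@le_trans _ _ ((1 - y / 8) ^+ 4)); last first.
    by rewrite ler_pXn2r ?nnegrE ?expR_ge0 ?expR_ge1Dx //; lra.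
  rewrite -subr_ge0.
  have -> : (1 - y / 8) ^+ 4 - t = y ^+ 2 * ((1 - y) / 128 + y ^+ 2 / 4096).
    by rewrite /t; field.
  by apply: mulr_ge0; have := sqr_ge0 y; lra.
move=> te; apply: (@le_trans _ _ (t ^+ 2 * (1 + y + y ^+ 2))); last first.
  by apply: ler_wpM2r te; have := sqr_ge0 y; lra.
rewrite -subr_ge0.
have -> : t ^+ 2 * (1 + y + y ^+ 2) - 1 = y ^+ 2 * (27 / 64 - 85 / 128 * y
    + (27 / 64 - 11 / 128 + 121 / 16384) * y ^+ 2
    - (11 / 128 - 121 / 16384) * y ^+ 3 + 121 / 16384 * y ^+ 4).
  by rewrite /t; field.
apply: mulr_ge0; first exact: sqr_ge0.
have y32 : y ^+ 3 <= y ^+ 2 by rewrite exprS ler_piMl ?sqr_ge0.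
have y4 : 0 <= y ^+ 4 by rewrite exprn_ge0 // ltW.
have := sqr_ge0 (y - 5 / 4); rewrite sqrrB.
move: y0 y2 y32 y4; move: (y ^+ 2) (y ^+ 3) (y ^+ 4) => a b c *; lra.
Qed.

(* Repeated squaring of [1 + x <= expR x] at [x = 1/128] and [x = - 1/64],
   rounding down to small fractions at each step. *)
Lemma expR1_bounds (R : realType) : 27 / 10 <= expR (1 : R) <= 11 / 4.
Proof.
have sqle (a b x : R) k : 0 <= a -> 0 <= b -> a <= b ^+ 2 -> b <= x ^+ k -> a <= x ^+ (k * 2).
  move=> a0 b0 ab bx; apply: le_trans ab _; rewrite exprM.
  by rewrite ler_sqr // ?nnegrE // (le_trans b0).
apply/andP; split.
  have h1 : 1 + 128^-1 <= expR (128^-1 : R) ^+ 1 :> R by rewrite expr1 expR_ge1Dx.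
  have h2 : 324 / 319 <= expR (128^-1 : R) ^+ (1 * 2) :> R by apply: (sqle _ _ _ _ _ _ _ h1); lra.
  have h4 : 98 / 95 <= expR (128^-1 : R) ^+ (1 * 2 * 2) :> R by apply: (sqle _ _ _ _ _ _ _ h2); lra.
  have h8 : 282 / 265 <= expR (128^-1 : R) ^+ (1 * 2 * 2 * 2) :> R by apply: (sqle _ _ _ _ _ _ _ h4); lra.
  have h16 : 325 / 287 <= expR (128^-1 : R) ^+ (1 * 2 * 2 * 2 * 2) :> R by apply: (sqle _ _ _ _ _ _ _ h8); lra.
  have h32 : 486 / 379 <= expR (128^-1 : R) ^+ (1 * 2 * 2 * 2 * 2 * 2) :> R by apply: (sqle _ _ _ _ _ _ _ h16); lra.
  have h64 : 319 / 194 <= expR (128^-1 : R) ^+ (1 * 2 * 2 * 2 * 2 * 2 * 2) :> R by apply: (sqle _ _ _ _ _ _ _ h32); lra.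
  have -> : expR 1 = expR (128^-1 : R) ^+ 128.
    by rewrite -expRM_natl mulfV ?pnatr_eq0.
  apply: (sqle _ _ _ (1 * 2 * 2 * 2 * 2 * 2 * 2)%N _ _ _ h64); lra.
rewrite -[expR 1]invrK -expRN -[11 / 4]invrK lef_pV2 ?posrE ?expR_gt0 ?invr_gt0 ?divr_gt0 //.
have h1 : 1 - 64^-1 <= expR (- 64^-1 : R) ^+ 1 :> R by rewrite expr1 expR_ge1Dx.
have h2 : 125 / 129 <= expR (- 64^-1 : R) ^+ (1 * 2) :> R by apply: (sqle _ _ _ _ _ _ _ h1); lra.
have h4 : 123 / 131 <= expR (- 64^-1 : R) ^+ (1 * 2 * 2) :> R by apply: (sqle _ _ _ _ _ _ _ h2); lra.
have h8 : 67 / 76 <= expR (- 64^-1 : R) ^+ (1 * 2 * 2 * 2) :> R by apply: (sqle _ _ _ _ _ _ _ h4); lra.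
have h16 : 143 / 184 <= expR (- 64^-1 : R) ^+ (1 * 2 * 2 * 2 * 2) :> R by apply: (sqle _ _ _ _ _ _ _ h8); lra.
have h32 : 61 / 101 <= expR (- 64^-1 : R) ^+ (1 * 2 * 2 * 2 * 2 * 2) :> R by apply: (sqle _ _ _ _ _ _ _ h16); lra.
have -> : expR (-1) = expR (- 64^-1 : R) ^+ 64.
  by rewrite -expRM_natl mulrN mulfV ?pnatr_eq0.
 apply: (sqle _ _ _ (1 * 2 * 2 * 2 * 2 * 2)%N _ _ _ h32); lra.
Qed.

(** Serves to exclude [ln q <= 5] when [32 * ln q < q]. On [1, 5], [expR (5 - u) >= 6 - u] reduces
    the bound to [expR 5 <= 160] and [(u - 1)(5 - u) >= 0]. *)
Lemma expR_le_32 (R : realType) (u : R) : 1 / 2 <= u <= 5 -> expR u <= 32 * u.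
Proof.
move=> /andP[u1 u5]; have /andP[_ e1] := expR1_bounds R.
have [u1'|u1'] := leP u 1.
  by apply: (@le_trans _ _ (expR 1)); [rewrite ler_expR | lra].
have e5 : expR 5 <= (160 : R).
  rewrite -[5]mulr1 expRM_natl; apply: (@le_trans _ _ ((11 / 4) ^+ 5)); last by lra.
  by rewrite ler_pXn2r ?nnegrE ?expR_ge0 //; lra.
have -> : u = 5 - (5 - u) by ring.
rewrite expRB ler_pdivrMr ?expR_gt0 //; apply: le_trans e5 _.
apply: (@le_trans _ _ (32 * (5 - (5 - u)) * (1 + (5 - u)))).
  by have : 0 <= (u - 1) * (5 - u); [rewrite mulr_ge0; lra | rewrite mulrBr !mulrBl; lra].
by apply: ler_wpM2l (expR_ge1Dx _); lra.
Qed.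

(** For [u = ln q] the left side is [q^(-1/3) ln q], which is thus kept away from 1. Past 5,
    [expR ((u - 5) / 3)] dominates [u / 5], so the value at [u = 5] decides. *)
Lemma mul_expR_third_le (R : realType) (u : R) :
  5 <= u -> u * expR (- (u / 3)) <= 96 / 100.
Proof.
move=> u5.
have /andP[e1 _] := expR1_bounds R.
have p0 : (0 : R) <= 5 / (96 / 100) by lra.
have e5 : (5 / (96 / 100)) <= expR (5 / 3) :> R.
  rewrite -(@ler_pXn2r _ 3) ?nnegrE ?p0 ?expR_ge0 //.
  rewrite -expRM_natl [3 * _](_ : _ = 5%:R * 1); last by field.
  rewrite expRM_natl; apply: (@le_trans _ _ ((27 / 10) ^+ 5)); first by lra.
  by rewrite ler_pXn2r ?nnegrE ?expR_ge0 //; lra.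
rewrite expRN ler_pdivrMr ?expR_gt0 //.
have -> : u / 3 = 5 / 3 + (u - 5) / 3 by field.
rewrite expRD; have := expR_ge1Dx ((u - 5) / 3).
set a := expR (5 / 3) in e5 *; set b := expR _ => hb.
have : (5 / (96 / 100)) * (1 + (u - 5) / 3) <= a * b.
  by apply: ler_pM => //; lra.
lra.
Qed.

(** * Colourings of the differences *)

Section SignRepresentatives.
Variables (G : finZmodType) (G2 : {set G}).
Hypothesis hG2 : half_system G2.

Definition index_set : {set G} := two_torsion G :|: G2.

(** [index_set] carries the independent bits; [sign_rep] selects the bit that decides both [z] and
    [- z], so differences are coloured irrespective of sign. *)
Definition sign_rep (z : G) : G := if z \in index_set then z else - z.

Lemma mem_two_torsion z : (z \in two_torsion G) = (z == - z).
Proof. by rewrite inE mulr2n addr_eq0. Qed.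

Lemma half_systemE z :
  z \notin two_torsion G -> (- z \in G2) = (z \notin G2).
Proof.
move=> zt; have /eqP/cards1P[a /finset.setP ha] := hG2.2 z zt.
have h1 := ha z; have h2 := ha (- z); move: h1 h2; rewrite !inE !eqxx /= orbT /=.
case: (z \in G2); case: (- z \in G2) => //=.
  move=> /esym/eqP <- /esym/eqP h; move: zt; rewrite mem_two_torsion.
  by rewrite h eqxx.
have := ha a; rewrite !inE eqxx => /andP[/orP[/eqP ->|/eqP ->] _]; by rewrite eqxx.
Qed.

Lemma sign_repE z : sign_rep z = z \/ sign_rep z = - z.
Proof. by rewrite /sign_rep; case: ifP; [left|right]. Qed.

Lemma sign_rep_in z : sign_rep z \in index_set.
Proof.
rewrite /sign_rep; case: ifP => // /negbT; rewrite !finset.in_setU negb_or.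
by move=> /andP[zt zG]; rewrite half_systemE // zG orbT.
Qed.

Lemma sign_repN z : sign_rep (- z) = sign_rep z.
Proof.
rewrite /sign_rep !finset.in_setU; have [zt|zt] := boolP (z \in two_torsion G).
  have /eqP zN : z == - z by rewrite -mem_two_torsion.
  by rewrite -!zN zt.
have -> : - z \in two_torsion G = false.
  by apply/negbTE; move: zt; rewrite !mem_two_torsion opprK eq_sym.
by rewrite /= half_systemE //; case: (z \in G2); rewrite ?opprK.
Qed.

(** A deterministic copy of [random_standard_set], which separates the combinatorics from the
    probability space. *)
Definition std_set (omega : G -> bool) : {set G} :=
  ([set 0] :|: [set y in two_torsion G | omega y]
    :|: \bigcup_(y in G2 | omega y) [set y; - y])%SET.

Lemma mem_std_set omega z :
  z != 0 -> (z \in std_set omega) = omega (sign_rep z).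
Proof.
move=> z0; rewrite /std_set !finset.in_setU finset.in_set1 (negbTE z0) /= inE.
have bigE : (z \in (\bigcup_(y in G2 | omega y) [set y; - y])%SET) =
    ((z \in G2) && omega z) || ((- z \in G2) && omega (- z)).
  apply/bigcupP/orP => [[y /andP[yG oy]]|[/andP[zG oz]|/andP[zG oz]]].
  - rewrite !inE => /orP[/eqP ->|/eqP ->]; first by left; rewrite yG oy.
    by right; rewrite opprK yG oy.
  - by exists z; rewrite ?zG ?oz // !inE eqxx.
  - by exists (- z); rewrite ?zG ?oz // !inE opprK eqxx orbT.
rewrite bigE /sign_rep finset.in_setU; have [zt|zt] := boolP (z \in two_torsion G).
  move: (zt); rewrite mem_two_torsion => /eqP <-.
  by case: (omega z); rewrite ?andbF.
rewrite half_systemE //=; case: (z \in G2); rewrite /= ?orbF //.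
Qed.

(** The colour [b] lets both parts of the theorem be treated at once: [true] for [Deltabar], [false]
    for [Delta]. *)
Definition clique (b : bool) (omega : G -> bool) (B : {set G}) : bool :=
  [forall x in B, forall y in B, (x != y) ==> (omega (sign_rep (x - y)) == b)].

Lemma cliqueP b omega (B : {set G}) :
  reflect {in B &, forall x y, x != y -> omega (sign_rep (x - y)) = b}
          (clique b omega B).
Proof.
apply: (iffP forall_inP) => h x.
  by move=> y xB yB xy; have /forall_inP/(_ y yB)/implyP/(_ xy)/eqP := h x xB.
move=> xB; apply/forall_inP => y yB; apply/implyP => xy; apply/eqP; exact: h.
Qed.

Lemma clique_Deltabar omega :
  exists2 B : {set G}, clique true omega B & #|B| = Deltabar (std_set omega).
Proof.
pose A := [pred B : {set G} | diffset B \subset std_set omega].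
have A0 : (0 < #|A|)%N.
  apply/card_gt0P; exists finset.set0; rewrite inE /=.
  by apply/fintype.subsetP => z /imset2P[x y]; rewrite inE.
have [B] := @eq_bigmax_cond _ A (fun B => #|B|) A0.
rewrite inE => BA E; exists B; last by rewrite -E.
apply/cliqueP => x y xB yB xy; rewrite -mem_std_set ?subr_eq0 //.
by apply: (fintype.subsetP BA); apply/imset2P; exists x y.
Qed.

Lemma clique_Delta omega :
  exists2 B : {set G}, clique false omega B & #|B| = Delta (std_set omega).
Proof.
pose A := [pred B : {set G} | diffset B :&: std_set omega == [set 0]%SET].
have A0 : (0 < #|A|)%N.
  (* The empty set is not admissible here, its difference set being empty, so the witness is a
     singleton. *)
  apply/card_gt0P; exists [set 0]%SET; rewrite inE /=; apply/eqP/finset.setP => z.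
  rewrite inE finset.in_set1; apply/andP/eqP => [[/imset2P[x y]]|->].
    by rewrite !finset.in_set1 => /eqP -> /eqP -> ->; rewrite subrr.
  split; last by rewrite !inE eqxx.
  by apply/imset2P; exists 0 0; rewrite ?finset.in_set1 ?subrr.
have [B] := @eq_bigmax_cond _ A (fun B => #|B|) A0.
rewrite inE => /eqP/finset.setP BA E; exists B; last by rewrite -E.
apply/cliqueP => x y xB yB xy; rewrite -mem_std_set ?subr_eq0 //.
apply/negP => h; have := BA (x - y); rewrite inE h finset.in_set1 subr_eq0 (negbTE xy).
by rewrite andbT => /negP; apply; apply/imset2P; exists x y.
Qed.

(** Positivity allows a strict upper bound on [Deltabar] to be inverted, since the inverse of 0 is
    0. *)
Lemma Deltabar_std_gt0 omega : (0 < Deltabar (std_set omega))%N.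
Proof.
rewrite /Deltabar; apply: (@leq_trans #|[set 0 : G]%SET|); first by rewrite cards1.
apply: (@leq_bigmax_cond _ _ (fun B : {set G} => #|B|)).
apply/fintype.subsetP => z /imset2P[x y].
by rewrite !finset.in_set1 => /eqP -> /eqP -> ->; rewrite subrr !inE eqxx.
Qed.

End SignRepresentatives.

(** * Product measures on finite families of bits *)

Section ProductMeasure.
Variables (R : realType) (I : finType) (W : I -> bool -> R).
Hypothesis W_ge0 : forall i b, 0 <= W i b.
Hypothesis W_sum1 : forall i, W i true + W i false = 1.

Definition weight (omega : {ffun I -> bool}) : R := \prod_i W i (omega i).

Definition Pr (E : pred {ffun I -> bool}) : R := \sum_(omega | E omega) weight omega.

Lemma weight_ge0 omega : 0 <= weight omega.
Proof. by apply: prodr_ge0 => i _; exact: W_ge0. Qed.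

Lemma expect_prod (f : I -> bool -> R) :
  \sum_omega weight omega * \prod_i f i (omega i) =
  \prod_i (W i true * f i true + W i false * f i false).
Proof.
transitivity (\prod_i \sum_b (W i b * f i b)); last first.
  by apply: eq_bigr => i _; rewrite big_bool.
by rewrite bigA_distr_bigA; apply: eq_bigr => omega _; rewrite big_split.
Qed.

Lemma Pr_predT : Pr predT = 1.
Proof.
have := expect_prod (fun _ _ => 1).
rewrite [RHS]big1 => [<-|i _]; last by rewrite !mulr1 W_sum1.
by apply: eq_bigr => omega _; rewrite big1 ?mulr1.
Qed.

Lemma PrC E : Pr E = 1 - Pr (predC E).
Proof. by rewrite -Pr_predT /Pr (bigID E predT) /= addrK. Qed.

(** Markov's inequality, with [h] majorizing the indicator of [E]. *)
Lemma le_expect (E : pred {ffun I -> bool}) (h : {ffun I -> bool} -> R) :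
  (forall omega, 0 <= h omega) -> (forall omega, E omega -> 1 <= h omega) ->
  Pr E <= \sum_omega weight omega * h omega.
Proof.
move=> h0 h1; rewrite /Pr big_mkcond; apply: ler_sum => omega _.
case: ifP => [/h1 Eo|_]; last by rewrite mulr_ge0 ?weight_ge0.
by rewrite ler_peMr ?weight_ge0.
Qed.

Lemma Pr_le (E F : pred {ffun I -> bool}) : (forall omega, E omega -> F omega) -> Pr E <= Pr F.
Proof.
move=> EF; rewrite /Pr big_mkcond [leRHS]big_mkcond; apply: ler_sum => omega _.
by case: ifP => [/EF ->//|_]; case: ifP => // _; exact: weight_ge0.
Qed.

Lemma Pr_exists (J : finType) (Q : pred J) (E : J -> pred {ffun I -> bool}) :
  Pr (fun omega => [exists (j | Q j), E j omega]) <= \sum_(j | Q j) Pr (E j).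
Proof.
rewrite /Pr (exchange_big_dep predT) //= big_mkcond; apply: ler_sum => omega _.
case: ifP => [/existsP[j /andP[Qj Ej]]|_]; last exact: sumr_ge0 (fun _ _ => weight_ge0 _).
rewrite (bigD1 j) ?Qj //= lerDl; apply: sumr_ge0 => *; exact: weight_ge0.
Qed.

(** The indicator of a cylinder is a product of functions of single bits, so [expect_prod]
    applies. *)
Lemma Pr_cylinder (J : {set I}) b :
  Pr (fun omega => [forall i in J, omega i == b]) = \prod_(i in J) W i b.
Proof.
have := expect_prod (fun i c => if i \in J then (c == b)%:R else 1).
have -> : \prod_i (W i true * (if i \in J then (true == b)%:R else 1)
    + W i false * (if i \in J then (false == b)%:R else 1)) = \prod_(i in J) W i b.
  rewrite [RHS]big_mkcond; apply: eq_bigr => i _; case: ifP => _.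
    by case: b; rewrite !(mulr1, mulr0, addr0, add0r).
  by rewrite !mulr1.
move=> <-; rewrite /Pr big_mkcond; apply: eq_bigr => omega _.
case: ifP => [/forall_inP h|/negbT].
  by rewrite big1 ?mulr1 // => i _; case: ifP => // /h ->.
rewrite negb_forall_in => /exists_inP[i iJ oi].
by rewrite (bigD1 i) //= iJ (negbTE oi) mul0r mulr0.
Qed.

End ProductMeasure.

(** * Rarity of large cliques *)

Lemma leq_bin_exp n m : ('C(n, m) <= n ^ m)%N.
Proof.
apply: (@leq_trans ('C(n, m) * m`!)%N); first by rewrite leq_pmulr ?fact_gt0.
rewrite bin_ffact ffact_prod -[m in (n ^ m)%N]card_ord -prod_nat_const.
by apply: leq_prod => i _; exact: leq_subr.
Qed.

(** The left side is the moment generating function, at [- u], of a centred bit of mean [r]. In the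
    quadratic bounds the linear terms cancel and the squares average to the variance [r (1 - r)]. *)
Lemma bernoulli_mgf (R : realType) (r u : R) : 0 <= r <= 1 -> `|u| <= 1 ->
  (1 - r) * expR (u * r) + r * expR (- (u * (1 - r))) <= expR (u ^+ 2 * (r * (1 - r))).
Proof.
move=> /andP[r0 r1] u1.
have h1 : expR (u * r) <= 1 + u * r + (u * r) ^+ 2.
  apply: expR_le_quadratic; rewrite normrM (ger0_norm r0).
  by apply: mulr_ile1.
have h2 : expR (- (u * (1 - r))) <= 1 + - (u * (1 - r)) + (- (u * (1 - r))) ^+ 2.
  apply: expR_le_quadratic; rewrite normrN normrM (@ger0_norm _ (1 - r)) ?subr_ge0 //.
  by apply: mulr_ile1; rewrite ?normr_ge0 //; lra.
apply: (@le_trans _ _ ((1 - r) * (1 + u * r + (u * r) ^+ 2) +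
    r * (1 + - (u * (1 - r)) + (- (u * (1 - r))) ^+ 2))).
  by apply: lerD; apply: ler_wpM2l; rewrite ?subr_ge0.
apply: le_trans (expR_ge1Dx _).
by rewrite le_eqVlt; apply/orP; left; apply/eqP; ring.
Qed.

(* Expanding an even [g] in characters and bounding every coefficient by the
   least one gives Hoffman's bound. *)
Lemma hoffman_bound (R : realType) (G : finZmodType) :
  exists2 c : 'I_(#|G|.-1.+1) -> G -> R, forall j z, `|c j z| <= 1 &
  forall g : G -> R, (forall z, g (- z) = g z) ->
  forall B : {set G}, exists j,
    (\sum_z g z * c j z) * #|B|%:R <= \sum_(x in B) \sum_(y in B) g (x - y).
Proof.
have [c [c1 cN cM cpos csum]] := real_characters R G.
exists c => // g gN B.
have q0 : 0 < #|G|%:R :> R by rewrite ltr0n; apply/card_gt0P; exists 0.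
pose gh j := \sum_z g z * c j z.
(* Fourier inversion. With real parts only, the product formula picks out both [u = z] and
   [u = - z], which agree because [g] is even. *)
have inv z : \sum_j gh j * c j z = #|G|%:R * g z.
  transitivity (\sum_u g u * (#|G|%:R * ((z - u == 0)%:R + (z + u == 0)%:R) / 2)).
    rewrite /gh (eq_bigr (fun j => \sum_u g u * c j u * c j z)); last first.
      by move=> j _; rewrite mulr_suml.
    rewrite exchange_big; apply: eq_bigr => u _.
    rewrite mulrDr -!csum -big_split mulr_suml mulr_sumr; apply: eq_bigr => j _.
    by rewrite /= cM; field.
  rewrite (eq_bigr (fun u => (u == z)%:R * (#|G|%:R * g u / 2)
      + (u == - z)%:R * (#|G|%:R * g u / 2))); last first.
    move=> u _; rewrite subr_eq0 [z == u]eq_sym.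
    have -> : (z + u == 0) = (u == - z) by rewrite addrC addr_eq0.
    by field.
  have pick (a : G) (F : G -> R) : \sum_u (u == a)%:R * F u = F a.
    rewrite (bigD1 a) //= eqxx mul1r big1 ?addr0 // => u /negbTE ->.
    by rewrite mul0r.
  by rewrite big_split /= !pick gN; field.
exists [arg min_(i < ord0) gh i]%O; case: arg_minP => // j0 _ jmin.
rewrite -(ler_pM2l q0).
have -> : #|G|%:R * \sum_(x in B) \sum_(y in B) g (x - y) =
    \sum_j gh j * \sum_(x in B) \sum_(y in B) c j (x - y).
  rewrite mulr_sumr; under [RHS]eq_bigr do rewrite mulr_sumr.
  rewrite [RHS]exchange_big; apply: eq_bigr => x _.
  rewrite mulr_sumr; under [RHS]eq_bigr do rewrite mulr_sumr.
  rewrite [RHS]exchange_big; apply: eq_bigr => y _.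
  by rewrite inv.
(* By orthogonality the nonnegative double sums of the [c j] add up to [#|G| * #|B|], so the
   comparison becomes termwise. *)
have -> : #|G|%:R * (gh j0 * #|B|%:R) =
    \sum_j gh j0 * \sum_(x in B) \sum_(y in B) c j (x - y).
  rewrite -mulr_sumr exchange_big /=; under eq_bigr do rewrite exchange_big /=.
  rewrite mulrCA; congr (_ * _); rewrite -[#|B|]sum1_card natr_sum mulr_sumr.
  apply: eq_bigr => x xB; under eq_bigr do rewrite csum.
  rewrite -mulr_sumr; congr (_ * _).
  rewrite (bigD1 x) //= subrr eqxx big1 ?addr0 // => y /andP[_ yx].
  by rewrite subr_eq0 eq_sym (negbTE yx).
by apply: ler_sum => j _; apply: ler_wpM2r; [exact: cpos | exact: jmin].
Qed.

Section RareCliques.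
Variables (R : realType) (G : finZmodType) (G2 : {set G}).
Hypothesis hG2 : half_system G2.
Variable W : G -> bool -> R.
Hypothesis W_ge0 : forall y b, 0 <= W y b.
Hypothesis W_sum1 : forall y, W y true + W y false = 1.
Local Notation rep := (sign_rep G2).
Local Notation q := (#|G|%:R : R).

(** Only [z] and [- z] can share a representative, so the nonzero differences are covered by the
    representatives and their negatives. *)
Lemma card_sign_rep_diffset (S : {set G}) :
  (#|diffset S|.-1 <= 2 * #|[set rep z | z in diffset S :\ (0 : G)%R]%SET|)%N.
Proof.
set T := [set rep z | z in _]%SET.
have : diffset S :\ 0 \subset T :|: [set - z | z in T]%SET.
  apply/fintype.subsetP => z zD; rewrite finset.in_setU.
  have zT : rep z \in T by apply: imset_f.
  case: (sign_repE G2 z) => E; first by rewrite -{1}E zT.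
  by apply/orP; right; apply/imsetP; exists (rep z) => //; rewrite E opprK.
move=> /subset_leq_card; rewrite cardsU (card_imset _ oppr_inj).
have := cardsD1 0 (diffset S); case: (0 \in _);
  move: #|diffset S| #|diffset S :\ 0| #|T| #|T :&: _| => *; lia.
Qed.

(* Union bound over the sets [S] of size [m ~ 11 L], [L = ln q / ln (1 / p)],
   with many differences: there are at most [q ^ m] of them, each with probability
   at most [p ^ (3 m (m - 1) / 16)]. *)
Lemma clique_rare b (p : R) : 0 < p < 1 ->
  (forall y, y \in index_set G2 -> W y b = p) -> 2 < ln q / ln (1 / p) ->
  Pr W (fun omega => [exists (B : {set G} | 576 * (ln q / ln (1 / p)) ^+ 2 <= #|B|%:R),
    clique G2 b omega B]) < expR (- (ln q ^+ 2 / ln (1 / p))).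
Proof.
move=> /andP[p0 p1] hW L2.
set l := ln (1 / p) in L2 *; set L := ln q / l in L2 *.
have l0 : 0 < l by rewrite ln_gt0 // div1r invf_gt1.
have lqE : ln q = L * l by rewrite /L mulfVK // gt_eqF.
have pE : p = expR (- l) by rewrite /l div1r lnV ?posrE // opprK lnK ?posrE.
have q0 : 0 < q by rewrite ltr0n; apply/card_gt0P; exists 0.
have L0 : 0 <= 11 * L by lra.
(* The successor is taken twice so that [m - 1 >= 11 L]; [L > 2] then gives
   [m <= 11 L + 2 <= 12 L]. *)
have /andP[t1 t2] := truncn_itv L0; set m := (Num.truncn (11 * L)).+2.
have mlo : 11 * L + 1 <= m%:R by rewrite /m -[in leRHS]addn1 natrD lerD2r ltW.
have mhi : m%:R <= 12 * L.
  by rewrite /m -[in leLHS]addn2 natrD; lra.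
pose reps (S : {set G}) := [set rep z | z in diffset S :\ 0]%SET.
pose Q (S : {set G}) := (#|S| == m) && (3 * (m * m.-1) <= 8 * #|diffset S|.-1)%N.
have step1 : Pr W (fun omega => [exists (B : {set G} | 576 * L ^+ 2 <= #|B|%:R),
      clique G2 b omega B]) <=
    Pr W (fun omega => [exists (S : {set G} | Q S), [forall y in reps S, omega y == b]]).
  apply: Pr_le => // omega /existsP[B /andP[Bbig /cliqueP cB]].
  have [|S [SB cS dS]] := @exists_subset_large_diffset _ B m.
    rewrite -(ler_nat R) natrM natrX; apply: le_trans Bbig.
    have -> : 576 * L ^+ 2 = 4 * (12 * L) ^+ 2 by ring.
    rewrite ler_pM2l //; apply: lerXn2r; rewrite ?nnegrE //; lra.
  apply/existsP; exists S; rewrite /Q cS eqxx dS /=.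
  apply/forall_inP => _ /imsetP[z + ->]; rewrite in_setD1 => /andP[z0].
  move=> /imset2P[x y xS yS zE]; apply/eqP; rewrite zE.
  apply: cB; rewrite ?(fintype.subsetP SB) //.
  by apply: contraNneq z0 => xy; rewrite zE xy subrr.
apply: (le_lt_trans step1).
apply: (le_lt_trans (Pr_exists W_ge0 _ _)).
have mm : (m.-1)%:R = m%:R - 1 :> R by rewrite /m /= [in RHS]mulrS addrC addrK.
(* Each [S] prescribes at least [3m(m - 1)/16] independent bits, half the number of its nonzero
   differences. *)
apply: (@le_lt_trans _ _ (\sum_(S | Q S) expR (- (3 / 16 * (m%:R * (m%:R - 1)) * l)))).
  apply: ler_sum => S /andP[_ dS]; rewrite Pr_cylinder //.
  rewrite (eq_bigr (fun _ => p)) => [|y /imsetP[z _ ->]]; last by rewrite hW ?sign_rep_in.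
  rewrite prodr_const pE -expRM_natr mulNr ler_expR lerN2 mulrC ler_pM2l //.
  have : (3 * (m * m.-1) <= 16 * #|reps S|)%N.
    apply: leq_trans dS _; rewrite -[16%N]/(8 * 2)%N -mulnA leq_mul2l /=.
    exact: card_sign_rep_diffset.
  by rewrite -(ler_nat R) !natrM mm; lra.
rewrite sumr_const.
apply: (@le_lt_trans _ _ (q ^+ m * expR (- (3 / 16 * (m%:R * (m%:R - 1)) * l)))).
  rewrite -[_ *+ _]mulr_natl ler_wpM2r ?expR_ge0 // -natrX ler_nat.
  apply: leq_trans (leq_bin_exp _ _); rewrite -card_draws.
  by apply/subset_leq_card/fintype.subsetP => S; rewrite !inE => /andP[].
have -> : q ^+ m = expR (m%:R * ln q) by rewrite expRM_natl lnK ?posrE.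
(* Since [m - 1 >= 11 L], the exponent is at most [(1 - 33/16) m L l], which is below [- L^2 l]
   because [m > L]. *)
rewrite -expRD ltr_expR expr2 [ln q * _ / l](_ : _ = L * (L * l)); last first.
  by rewrite lqE; field; rewrite gt_eqF.
rewrite lqE; have Ll : 0 < L * l by rewrite mulr_gt0 //; lra.
have h1 : 11 * L * (m%:R * l) <= (m%:R - 1) * (m%:R * l).
  by apply: ler_wpM2r; [rewrite mulr_ge0 ?ltW | lra].
have h2 : L * (L * l) < m%:R * (L * l) by rewrite ltr_pM2r //; lra.
have h3 : 0 < m%:R * (L * l) by rewrite mulr_gt0.
move: h1 h2 h3.
have -> : 11 * L * (m%:R * l) = 11 * (m%:R * (L * l)) by ring.
have -> : (m%:R - 1) * (m%:R * l) = m%:R * (m%:R - 1) * l by ring.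
lra.
Qed.

(** Chernoff's method: Markov's inequality for the exponential of [- lam] times the sum, which
    factors by independence, each factor being bounded by [bernoulli_mgf]. *)
Lemma bernoulli_sum_tail (lam s r : R) b (a : G -> R) :
  0 <= lam -> 0 <= r <= 1 ->
  (forall y, `|lam * a y| <= 1) -> (forall y, y \notin index_set G2 -> a y = 0) ->
  (forall y, y \in index_set G2 -> W y b = 1 - r) ->
  Pr W (fun omega => \sum_y a y * ((omega y != b)%:R - r) <= - s) <=
    expR (lam ^+ 2 * (r * (1 - r)) * (\sum_y a y ^+ 2) - lam * s).
Proof.
move=> lam0 r01 a1 a0 hW.
pose f y c := expR (- (lam * a y * ((c != b)%:R - r))).
have hE (omega : {ffun G -> bool}) :
    expR (- (lam * (\sum_y a y * ((omega y != b)%:R - r) + s))) =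
    expR (- (lam * s)) * \prod_y f y (omega y).
  rewrite -expR_sum -expRD sumrN mulrDr opprD addrC mulr_sumr.
  by congr (expR (_ - _)); apply: eq_bigr => y _; rewrite mulrA.
apply: le_trans (le_expect W_ge0 (h := fun omega =>
  expR (- (lam * (\sum_y a y * ((omega y != b)%:R - r) + s)))) _ _) _.
- by move=> omega; exact: expR_ge0.
- move=> omega h; rewrite -[leLHS]expR0 ler_expR oppr_ge0 mulr_ge0_le0 //.
  by rewrite -lerBrDr sub0r.
rewrite (eq_bigr (fun omega => expR (- (lam * s)) *
    (weight W omega * \prod_y f y (omega y)))); last first.
  by move=> omega _; rewrite hE mulrCA.
rewrite -mulr_sumr expect_prod addrC expRD ler_wpM2l ?expR_ge0 //.
rewrite mulr_sumr expR_sum; apply: ler_prod => y _; apply/andP; split.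
  by rewrite addr_ge0 // mulr_ge0 // expR_ge0.
have [yI|yI] := boolP (y \in index_set G2); last first.
  by rewrite /f a0 // !mulr0 !mul0r oppr0 !expR0 expr0n mulr0 expR0 !mulr1 W_sum1.
have WN : W y (~~ b) = r.
  by have := W_sum1 y; have := hW y yI; case: (b) => /= ->; lra.
have -> : W y true * f y true + W y false * f y false =
    W y b * f y b + W y (~~ b) * f y (~~ b) by case: (b) => //=; rewrite addrC.
rewrite WN hW // /f eqxx.
have -> : (~~ b != b) by case: (b).
have -> : lam ^+ 2 * (r * (1 - r)) * a y ^+ 2 = (lam * a y) ^+ 2 * (r * (1 - r)) by ring.
by have := bernoulli_mgf r01 (a1 y); rewrite sub0r mulrN opprK.
Qed.

(* [sign_rep] is at most two-to-one, so the coefficients of the independent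
   variables satisfy [|a y| <= 2] and [sum_y (a y)^2 <= 2 q]. *)
Lemma sign_rep_fiber (c : G -> R) (a := fun y => \sum_(z | (z != 0) && (rep z == y)) c z) :
  (forall z, `|c z| <= 1) ->
  [/\ forall y, `|a y| <= 2, forall y, y \notin index_set G2 -> a y = 0 &
      \sum_y a y ^+ 2 <= 2 * q].
Proof.
move=> c1.
pose n y := #|[set z | (z != 0) && (rep z == y)]%SET|.
have an y : `|a y| <= (n y)%:R.
  rewrite /a /n -sum1dep_card natr_sum; apply: le_trans (ler_norm_sum _ _ _) _.
  exact: ler_sum.
have n2 y : (n y <= 2)%N.
  apply: (@leq_trans #|[set y; - y]%SET|); last by rewrite cards2; case: (_ != _).
  apply/subset_leq_card/fintype.subsetP => z; rewrite !inE => /andP[_ /eqP <-].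
  by case: (sign_repE G2 z) => ->; rewrite ?opprK eqxx ?orbT.
split => [y|y yI|].
- by apply: le_trans (an y) _; rewrite ler_nat.
- rewrite /a big1 // => z /andP[_ /eqP zy].
  by rewrite -zy sign_rep_in in yI.
- apply: (@le_trans _ _ (\sum_y 2 * (n y)%:R)).
    apply: ler_sum => y _; rewrite -[_ ^+ 2]real_normK ?num_real //.
    apply: (@le_trans _ _ ((n y)%:R ^+ 2)); first by rewrite ler_sqr ?nnegrE.
    by rewrite expr2 ler_wpM2r // ler_nat.
  rewrite -mulr_sumr ler_pM2l // -natr_sum ler_nat.
  rewrite /n (eq_bigr (fun y => \sum_(z | (z != 0%R) && (rep z == y)) 1)%N); last first.
    by move=> y _; rewrite sum1dep_card.
  rewrite -(partition_big rep predT) //= sum1_card; exact: max_card.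
Qed.

(* Chernoff's bound with parameter [lam = sqrt (k / N) / 2], where
   [N = q r (1 - r)]; [k <= N] keeps all exponents in the range of
   [expR_le_quadratic]. *)
Lemma clique_rare_dense b (r k : R) : 0 < r < 1 -> 0 < k <= q * (r * (1 - r)) ->
  (forall y, y \in index_set G2 -> W y b = 1 - r) ->
  Pr W (fun omega => [exists (B : {set G} |
      3 * Num.sqrt k * Num.sqrt ((1 - r) * q / r) <= #|B|%:R),
    clique G2 b omega B]) < 2 * (q * expR (- k)).
Proof.
move=> /andP[r0 r1] /andP[k0 kN] hW.
have q0 : 0 < q by rewrite ltr0n; apply/card_gt0P; exists 0.
set N := q * (r * (1 - r)) in kN *.
have N0 : 0 < N by exact: lt_le_trans k0 kN.
pose s := Num.sqrt k; pose n := Num.sqrt N.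
have s2 : s ^+ 2 = k by rewrite sqr_sqrtr // ltW.
have n2 : n ^+ 2 = N by rewrite sqr_sqrtr // ltW.
have s0 : 0 < s by rewrite sqrtr_gt0.
have n0 : 0 < n by rewrite sqrtr_gt0.
have sn : s <= n by rewrite ler_sqrt // ltW.
have ME : 3 * Num.sqrt k * Num.sqrt ((1 - r) * q / r) = 3 * s * (n / r).
  congr (_ * _); have -> : (1 - r) * q / r = (n / r) ^+ 2.
    by rewrite expr_div_n n2 /N; field; rewrite gt_eqF.
  by rewrite sqrtr_sqr ger0_norm // divr_ge0 // ltW.
rewrite ME; pose M := 3 * s * (n / r); rewrite -/M.
pose lam := s / (2 * n).
have lam0 : 0 < lam by rewrite divr_gt0 // mulr_gt0.
have lam1 : lam <= 1 / 2.
  rewrite /lam ler_pdivrMr ?mulr_gt0 //; lra.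
have [c c1 hoff] := hoffman_bound R G.
pose a j y := \sum_(z | (z != 0) && (rep z == y)) c j z.
(* Hoffman's bound gives a coefficient at most [- r (#|B| - 1)], and [r * M = 3 s n]; the shift by
   [r] comes from the omitted diagonal. *)
pose t := 3 * s * n - r.
have step : Pr W (fun omega => [exists (B : {set G} | M <= #|B|%:R), clique G2 b omega B])
    <= Pr W (fun omega => [exists (j | predT j),
         \sum_y a j y * ((omega y != b)%:R - r) <= - t]).
  apply: Pr_le => // omega /existsP[B /andP[MB /cliqueP cB]].
  (* Away from 0 this is the centred indicator of the wrong colour; it equals [- r] at every nonzero
     difference of a clique. *)
  pose g z := if z == 0 then 0 else (omega (rep z) != b)%:R - r.
  have gN z : g (- z) = g z by rewrite /g oppr_eq0 sign_repN.
  have [j hj] := hoff g gN B; apply/existsP; exists j => /=.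
  have B0 : 0 < #|B|%:R :> R.
    by apply: lt_le_trans MB; rewrite /M mulr_gt0 ?divr_gt0 // mulr_gt0.
  rewrite -(ler_pM2r B0).
  have -> : \sum_y a j y * ((omega y != b)%:R - r) = \sum_z g z * c j z.
    rewrite [RHS](bigD1 0) //= {1}/g eqxx mul0r add0r.
    rewrite [RHS](partition_big rep predT) //=; apply: eq_bigr => y _.
    rewrite /a mulr_suml; apply: eq_bigr => z /andP[z0 /eqP <-].
    by rewrite /g (negbTE z0) mulrC.
  apply: (le_trans hj).
  have -> : \sum_(x in B) \sum_(y in B) g (x - y) = - (r * (#|B|%:R - 1)) * #|B|%:R.
    rewrite mulr_natr -sumr_const; apply: eq_bigr => x xB.
    rewrite (bigD1 x) //= /g subrr eqxx add0r.
    rewrite (eq_bigr (fun _ => - r)); last first.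
      move=> y /andP[yB yx]; rewrite subr_eq0 eq_sym (negbTE yx).
      by rewrite cB // 1?eq_sym // eqxx sub0r.
    rewrite sumr_const (cardD1 x B) xB natrD addrAC subrr add0r mulr_natr.
    by rewrite mulNrn; congr (- (_ *+ _)); apply: eq_card => y; rewrite !inE andbC.
  rewrite ler_pM2r // lerN2 /t.
  have : r * M <= r * #|B|%:R by rewrite ler_pM2l.
  have -> : r * M = 3 * s * n by rewrite /M; field; rewrite gt_eqF.
  by rewrite mulrBr mulr1; lra.
apply: (le_lt_trans step); apply: (le_lt_trans (Pr_exists W_ge0 _ _)).
(* The variance term contributes [k/2], while [lam * t = 3k/2 - lam r] with [lam r <= 1/2]. The
   leftover factor [expR (1/2)] is below 2. *)
apply: (@le_lt_trans _ _ (\sum_(j < #|G|.-1.+1) expR (1 / 2 - k))).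
  apply: ler_sum => j _.
  have [a2 aI aS] := sign_rep_fiber (c1 j).
  apply: le_trans (@bernoulli_sum_tail lam t r b (a j) (ltW lam0) _ _ aI hW) _; first by lra.
    move=> y; rewrite normrM (gtr0_norm lam0).
    apply: (@le_trans _ _ (1 / 2 * 2)); last by lra.
    by apply: ler_pM; [exact: ltW | exact: normr_ge0 | exact: lam1 | exact: a2].
  rewrite ler_expR.
  have : lam ^+ 2 * (r * (1 - r)) * \sum_y a j y ^+ 2 <= lam ^+ 2 * (r * (1 - r)) * (2 * q).
    by apply: ler_wpM2l aS; rewrite mulr_ge0 ?sqr_ge0 // mulr_ge0; lra.
  have -> : lam ^+ 2 * (r * (1 - r)) * (2 * q) = k / 2.
    transitivity (2 * lam ^+ 2 * n ^+ 2); first by rewrite n2 /N; ring.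
    by rewrite /lam -s2; field; rewrite gt_eqF.
  have -> : lam * t = 3 / 2 * k - lam * r.
    by rewrite /t /lam -s2; field; rewrite gt_eqF.
  have : lam * r <= 1 / 2 * 1 by apply: ler_pM; rewrite ?(ltW lam0) ?(ltW r0) ?(ltW r1).
  lra.
rewrite sumr_const card_ord prednK; last by rewrite -(ltr0n R).
rewrite -[_ *+ _]mulr_natl mulrCA ltr_pM2l // expRD ltr_pM2r ?expR_gt0 //.
have := @expR_le_quadratic R (1 / 2); rewrite ger0_norm ?divr_ge0 // => /(_ _).
by move=> h; have : expR (1 / 2 : R) <= 1 + 1 / 2 + (1 / 2) ^+ 2; [apply: h|]; lra.
Qed.

End RareCliques.

(** * Transfer to the probability space *)

Section Transfer.
Context (d : measure_display) (T : measurableType d) (R : realType).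
Variables (P : probability T R) (G : finZmodType) (rho : R) (G2 : {set G}).
Variable xi : G -> {RV P >-> bool}.
Hypothesis hG2 : half_system G2.
Hypothesis hxi : bernoulli_family rho G2 xi.

(** The law of one coordinate of [pattern]. Off [index_set], where [xi] is unconstrained, the
    coordinate is constantly [false], so that a product measure lives on all functions on [G]. *)
Definition bernoulli_weight (y : G) (c : bool) : R :=
  if y \in index_set G2 then (if c then rho else 1 - rho) else (~~ c)%:R.

Definition pattern (w : T) : {ffun G -> bool} :=
  [ffun y => (y \in index_set G2) && xi y w].

Lemma random_standard_setE w :
  random_standard_set G2 xi w = std_set G2 (pattern w).
Proof.
rewrite /random_standard_set /std_set; congr (_ :|: _ :|: _).
  apply/finset.setP => y; rewrite !inE ffunE finset.in_setU inE.
  by case: (y *+ 2 == 0).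
apply: eq_bigl => y; rewrite ffunE finset.in_setU.
by case: (y \in G2); rewrite ?andbF // orbT.
Qed.

Lemma measurable_xi y (B : set bool) : measurable (xi y @^-1` B)%classic.
Proof. by rewrite -[X in measurable X]setTI; exact: (measurable_funPT (xi y)). Qed.

Lemma prob_xi y c : y \in index_set G2 ->
  P (xi y @^-1` [set c])%classic = (bernoulli_weight y c)%:E.
Proof.
move=> yI; rewrite /bernoulli_weight yI; have Pt := hxi.2 y yI.
case: c => //; have -> : (xi y @^-1` [set false] = ~` (xi y @^-1` [set true]))%classic.
  by apply/seteqP; split => w /=; case: (xi y w).
by rewrite probability_setC ?[X in (1 - X)%E]Pt //; exact: measurable_xi.
Qed.

Lemma rho_itv : 0 <= rho <= 1.
Proof.
have I0 : 0 \in index_set G2 by rewrite finset.in_setU inE mul0rn eqxx.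
have := hxi.2 _ I0 => Pt; rewrite -!lee_fin -Pt measure_ge0.
by rewrite probability_le1 //; exact: (measurable_xi 0 [set true]%classic).
Qed.

Lemma bernoulli_weight_ge0 y c : 0 <= bernoulli_weight y c.
Proof.
have /andP[r0 r1] := rho_itv.
by rewrite /bernoulli_weight; case: ifP => // _; case: c; rewrite ?subr_ge0.
Qed.

Lemma bernoulli_weight_sum1 y : bernoulli_weight y true + bernoulli_weight y false = 1.
Proof.
by rewrite /bernoulli_weight; case: ifP => _; rewrite ?add0r // addrC subrK.
Qed.

Lemma pattern_preimage (omega : {ffun G -> bool}) :
  (forall y, y \notin index_set G2 -> omega y = false) ->
  [set w | pattern w = omega]%classic =
  (\bigcap_(y in [set` index_set G2]) (xi y @^-1` [set omega y]))%classic.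
Proof.
move=> h0; apply/seteqP; split => w /=.
  by move=> <- y /= yI; rewrite ffunE yI.
move=> h; apply/ffunP => y; rewrite ffunE.
by case: (boolP (y \in index_set G2)) => [yI|/h0 ->//]; exact: h.
Qed.

Lemma pattern_eq0 (omega : {ffun G -> bool}) y :
  y \notin index_set G2 -> omega y -> [set w | pattern w = omega]%classic = set0.
Proof.
move=> yI oy; apply/seteqP; split => w //= E.
by move: oy; rewrite -E ffunE (negbTE yI).
Qed.

Lemma measurable_pattern omega : measurable [set w | pattern w = omega]%classic.
Proof.
have [/exists_inP[y yI oy]|] := boolP [exists y in ~: index_set G2, omega y].
  by rewrite (@pattern_eq0 omega y) // -finset.in_setC.
rewrite negb_exists_in => /forall_inP h; rewrite pattern_preimage.
  by apply: fin_bigcap_measurable => // y _; exact: measurable_xi.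
by move=> y yI; apply/negbTE/h; rewrite finset.in_setC.
Qed.

(** Mutual independence enters here, applied to the whole of [index_set]. *)
Lemma prob_pattern omega :
  P [set w | pattern w = omega]%classic = (weight bernoulli_weight omega)%:E.
Proof.
have [/exists_inP[y]|] := boolP [exists y in ~: index_set G2, omega y].
  rewrite finset.in_setC => yI oy.
  rewrite (@pattern_eq0 omega y) // measure0 /weight (bigD1 y) //=.
  by rewrite {1}/bernoulli_weight (negbTE yI) oy mul0r.
rewrite negb_exists_in => /forall_inP h.
have h0 y : y \notin index_set G2 -> omega y = false.
  by move=> yI; apply/negbTE/h; rewrite finset.in_setC.
rewrite pattern_preimage // (hxi.1 (index_set G2) _ (fun y => [set omega y]%classic)) //.
rewrite (eq_bigr (fun y => (bernoulli_weight y (omega y))%:E)) => [|y yI]; last exact: prob_xi.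
rewrite prodEFin /weight [in RHS](bigID (mem (index_set G2))) /= [X in _ * X]big1 ?mulr1 //.
by move=> y yI; rewrite /bernoulli_weight (negbTE yI) h0.
Qed.

Lemma prob_pred_pattern (E : pred {ffun G -> bool}) :
  P [set w | E (pattern w)]%classic = (Pr bernoulli_weight E)%:E.
Proof.
pose r := [seq omega <- index_enum {ffun G -> bool} | E omega].
have ur : uniq r by rewrite filter_uniq // index_enum_uniq.
have memr omega : (omega \in r) = E omega by rewrite mem_filter mem_index_enum andbT.
have -> : [set w | E (pattern w)]%classic =
    (\bigcup_(omega in [set` r]) [set w | pattern w = omega])%classic.
  apply/seteqP; split => w /=.
    by move=> Ew; exists (pattern w) => //=; rewrite memr.
  by move=> [omega /= + ->]; rewrite memr.
rewrite measure_fin_bigcup //.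
- rewrite -fsbig_seq // /Pr -sumEFin -[RHS]big_filter.
  by apply: eq_bigr => omega _; exact: prob_pattern.
- by move=> o1 o2 _ _ [w [/= <- <-]].
- by move=> omega _; exact: measurable_pattern.
Qed.

(** An event about the random set is a finite union of pattern events, so its probability is
    computed by [Pr]. *)
Lemma prob_random_standard_set_gt (Q : {set G} -> Prop) (bad : pred {ffun G -> bool}) eps :
  (forall omega, ~~ bad omega -> Q (std_set G2 omega)) ->
  Pr bernoulli_weight bad < eps ->
  (P [set w | Q (random_standard_set G2 xi w)]%classic > (1 - eps)%:E)%E.
Proof.
move=> hQ hbad; pose E (omega : {ffun G -> bool}) := `[< Q (std_set G2 omega) >].
have -> : [set w | Q (random_standard_set G2 xi w)]%classic = [set w | E (pattern w)]%classic.
  by apply/seteqP; split => w /=; rewrite random_standard_setE => /asboolP.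
rewrite prob_pred_pattern lte_fin PrC; last exact: bernoulli_weight_sum1.
rewrite ltrD2l ltrN2; apply: le_lt_trans hbad.
apply: Pr_le => [|omega /= /asboolPn nQ]; first exact: bernoulli_weight_ge0.
by apply/negPn/negP => /hQ.
Qed.

End Transfer.

(** * Parameter ranges and conclusion *)

Lemma two_lt_ln_ratio (R : realType) (q p : R) : 1 <= q -> p < 1 ->
  q `^ (- (1 / 2)) < p -> 0 < p /\ 2 < ln q / ln (1 / p).
Proof.
move=> q1 p1 qp.
have q0 : 0 < q by exact: lt_le_trans q1.
have p0 : 0 < p by apply: le_lt_trans qp; exact: powR_ge0.
split=> //; have l0 : 0 < ln (1 / p) by rewrite ln_gt0 // div1r invf_gt1.
rewrite ltr_pdivlMr //.
(* Logarithms turn the lower bound on [p] into [ln (1 / p) < ln q / 2]. *)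
have : ln (q `^ (- (1 / 2))) < ln p by rewrite ltr_ln ?posrE ?powR_gt0.
by rewrite ln_powR [1 / p]div1r lnV ?posrE //; lra.
Qed.

(* The upper bound on [c] forces [ln q > 5], hence [r < 0.96]. *)
Lemma dense_range (R : realType) (q r c : R) : q = 1 \/ 2 <= q ->
  1 < c -> c < q / (32 * ln q) -> 16 * c * (ln q / q) < r ->
  r < q `^ (- (1 / 3)) * ln q ->
  [/\ 0 < r, r < 1 & 0 < c * ln q <= q * (r * (1 - r))].
Proof.
(* For [q = 1] the quotient by [32 * ln q] is 0 by convention, contradicting [1 < c]. *)
move=> [->|q2] c1; first by rewrite ln1 mulr0 invr0 mulr0; lra.
have q0 : 0 < q by lra.
set u := ln q; have qE : q = expR u by rewrite lnK.
have u0 : 1 / 2 <= u.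
  rewrite -ler_expR -qE; apply: le_trans q2.
  apply: le_trans (expR_le_quadratic _) _; last by lra.
  by rewrite ger0_norm; lra.
have u32 : 0 < 32 * u by lra.
rewrite ltr_pdivlMr // => cq hr1 hr2.
have uq : 32 * u < q.
  by apply: lt_trans cq; rewrite ltr_pMl.
have u5 : 5 < u.
  rewrite ltNge; apply/negP => u5.
  by have := @expR_le_32 R u; rewrite u0 u5 -qE => /(_ isT); lra.
have r96 : r < 96 / 100.
  apply: lt_le_trans hr2 _.
  have -> : q `^ (- (1 / 3)) = expR (- (u / 3)).
    by rewrite /powR gt_eqF // -/u; congr expR; field.
  by rewrite mulrC; apply: mul_expR_third_le; exact: ltW.
have cu0 : 0 < c * u by rewrite mulr_gt0; lra.
have hr : 16 * (c * u) < r * q.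
  by move: hr1; rewrite mulrA ltr_pdivrMr // -!mulrA.
have r0 : 0 < r by rewrite -(pmulr_lgt0 _ q0); lra.
split; [by []|by lra|rewrite cu0 /=].
(* For [r <= 1/2] the lower bound on [r] suffices; otherwise [r < 0.96] gives [r (1 - r) >= 1/32],
   and [32 * c * ln q < q] concludes. *)
have [rs|rl] := leP r (1 / 2).
  apply: (@le_trans _ _ (q * (r * (1 / 2)))); first by lra.
  by rewrite ler_pM2l // ler_pM2l //; lra.
apply: (@le_trans _ _ (q * (1 / 32))); first by lra.
rewrite ler_pM2l //.
have : 0 <= (r - 1 / 2) * (96 / 100 - r) by rewrite mulr_ge0; lra.
by rewrite mulrBr !mulrBl mulrBr mulr1; lra.
Qed.

Section TransferBounds.
Context (d : measure_display) (T : measurableType d) (R : realType).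
Variables (P : probability T R) (G : finZmodType) (rho : R) (G2 : {set G}).
Variable xi : G -> {RV P >-> bool}.
Hypothesis hG2 : half_system G2.
Hypothesis hxi : bernoulli_family rho G2 xi.
Local Notation Rset := (random_standard_set G2 xi).

Lemma prob_Deltabar_gt (M N eps : R) : M * N = 1 -> 0 < M ->
  Pr (bernoulli_weight rho G2)
    (fun omega => [exists (B : {set G} | M <= #|B|%:R), clique G2 true omega B]) < eps ->
  (P [set w | ((Deltabar (Rset w))%:R < M)%R /\ (deltabar R (Rset w) > N)%R]%classic
     > (1 - eps)%:E)%E.
Proof.
move=> MN M0 hPr; pose Q (A : {set G}) := (Deltabar A)%:R < M /\ deltabar R A > N.
apply: (prob_random_standard_set_gt hxi (Q := Q) _ hPr) => omega nB.
have lt : (Deltabar (std_set G2 omega))%:R < M.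
  have [B cB <-] := clique_Deltabar hG2 omega.
  rewrite ltNge; apply: contra nB => h; apply/existsP; exists B.
  by rewrite h cB.
split=> //; rewrite /deltabar.
have -> : N = M^-1 by rewrite -[RHS]mulr1 -MN mulKf // gt_eqF.
by rewrite ltf_pV2 // posrE ltr0n Deltabar_std_gt0.
Qed.

Lemma prob_Delta_gt (M N eps : R) : M / #|G|%:R = N ->
  Pr (bernoulli_weight rho G2)
    (fun omega => [exists (B : {set G} | M <= #|B|%:R), clique G2 false omega B]) < eps ->
  (P [set w | ((Delta (Rset w))%:R < M)%R /\ (delta R (Rset w) < N)%R]%classic
     > (1 - eps)%:E)%E.
Proof.
move=> MN hPr; pose Q (A : {set G}) := (Delta A)%:R < M /\ delta R A < N.
apply: (prob_random_standard_set_gt hxi (Q := Q) _ hPr) => omega nB.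
have lt : (Delta (std_set G2 omega))%:R < M.
  have [B cB <-] := clique_Delta hG2 omega.
  rewrite ltNge; apply: contra nB => h; apply/existsP; exists B.
  by rewrite h cB.
split=> //; rewrite /delta -MN ltr_pM2r // invr_gt0 ltr0n.
by apply/card_gt0P; exists 0.
Qed.

End TransferBounds.

Theorem theorem9p3 (R : realType) :
  exists c1 c2 : R, 0 < c1 /\ 0 < c2 /\
  forall (G : finZmodType) (q : R), q = #|G|%:R ->
  forall (d : measure_display) (T : measurableType d) (P : probability T R)
    (rho : R) (G2 : {set G}) (xi : G -> {RV P >-> bool}),
  half_system G2 -> bernoulli_family rho G2 xi ->
  let Rset := random_standard_set G2 xi in
  ((q `^ (- (1 / 2)) < rho -> rho < 1 - q `^ (- (1 / 3)) * ln q ->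
     (P [set w | ((Deltabar (Rset w))%:R < c2 * (ln q / ln (1 / rho)) ^+ 2)%R /\
                 (deltabar R (Rset w) > 1 / c2 * (ln (1 / rho) / ln q) ^+ 2)%R]%classic
      > (1 - expR (- (c1 * ln q ^+ 2 / ln (1 / rho))))%R%:E)%E)
   /\
   (forall c : R, 1 < c -> c < q / (32 * ln q) ->
     1 - q `^ (- (1 / 3)) * ln q < rho -> rho < 1 - 16 * c * (ln q / q) ->
     (P [set w | ((Deltabar (Rset w))%:R
                   < 3 * Num.sqrt (c * ln q) * Num.sqrt (rho * q / (1 - rho)))%R /\
                 (deltabar R (Rset w)
                   > 1 / (3 * Num.sqrt (c * ln q))
                     * Num.sqrt ((1 - rho) / (rho * q)))%R]%classic
      > (1 - 2 * q `^ (1 - c))%R%:E)%E))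
  /\
  ((q `^ (- (1 / 3)) * ln q < rho -> rho < 1 - q `^ (- (1 / 2)) ->
     (P [set w | ((Delta (Rset w))%:R < c2 * (ln q / ln (1 / (1 - rho))) ^+ 2)%R /\
                 (delta R (Rset w)
                   < c2 / q * (ln q / ln (1 / (1 - rho))) ^+ 2)%R]%classic
      > (1 - expR (- (c1 * ln q ^+ 2 / ln (1 / (1 - rho)))))%R%:E)%E)
   /\
   (forall c : R, 1 < c -> c < q / (32 * ln q) ->
     16 * c * (ln q / q) < rho -> rho < q `^ (- (1 / 3)) * ln q ->
     (P [set w | ((Delta (Rset w))%:R
                   < 3 * Num.sqrt (c * ln q) * Num.sqrt ((1 - rho) * q / rho))%R /\
                 (delta R (Rset w)
                   < 3 * Num.sqrt (c * ln q)
                     * Num.sqrt ((1 - rho) / (rho * q)))%R]%classic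
      > (1 - 2 * q `^ (1 - c))%R%:E)%E)).
Proof.
(* [576 = 4 * 12^2]: the greedy choice needs [4 m^2] elements, with [m <= 12 L]. *)
exists 1, 576; split; first by []; split; first by [].
move=> G q qE d T P rho G2 xi hG2 hxi Rset.
have q_gt0 : (0 < #|G|)%N by apply/card_gt0P; exists 0.
have q1 : 1 <= q by rewrite qE ler1n.
have q0 : 0 < q by lra.
have q12 : q = 1 \/ 2 <= q.
  rewrite qE; case: (#|G|) q_gt0 => [//|[|n]] _; [by left | by right; rewrite ler_nat].
have lnq0 : 0 <= ln q by rewrite ln_ge0.
have W0 := bernoulli_weight_ge0 hxi; have W1 := bernoulli_weight_sum1 rho G2.
have Wt y : y \in index_set G2 -> bernoulli_weight rho G2 y true = rho.
  by rewrite /bernoulli_weight => ->.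
have Wf y : y \in index_set G2 -> bernoulli_weight rho G2 y false = 1 - rho.
  by rewrite /bernoulli_weight => ->.
have tail0 : 0 <= q `^ (- (1 / 3)) * ln q by rewrite mulr_ge0 ?powR_ge0.
have powE c : q `^ (1 - c) = q * expR (- (c * ln q)).
  by rewrite /powR gt_eqF // mulrBl mul1r expRD lnK ?posrE.
have ratio_gt0 x : 2 < ln q / ln (1 / x) -> 0 < (576 : R) * (ln q / ln (1 / x)) ^+ 2.
  by move=> h; rewrite mulr_gt0 // exprn_gt0 //; lra.
split; split.
- move=> h1 h2; have [r0 L2] : 0 < rho /\ 2 < ln q / ln (1 / rho).
    by apply: two_lt_ln_ratio => //; lra.
  apply: (prob_Deltabar_gt hG2 hxi); last first.
  + rewrite [1 * ln q ^+ 2]mul1r; rewrite qE in L2 *; apply: (clique_rare hG2 W0 W1 _ Wt) => //.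
    by rewrite r0; lra.
  + exact: ratio_gt0.
  rewrite -[ln (1 / rho) / ln q]invf_div mulrACA -exprMn mulfV; last first.
    by rewrite gt_eqF //; lra.
  by rewrite expr1n mulr1 mul1r mulfV.
- move=> c c1 c2 h1 h2.
  (* For cliques of colour [true] the wrong colour has probability [1 - rho], which takes the place
     of [r]. *)
  have [||r0 r1 kN] := @dense_range R q (1 - rho) c q12 c1 c2; [lra|lra|].
  have /andP[k0 _] := kN.
  have v0 : 0 < rho * q / (1 - rho) by rewrite divr_gt0 // mulr_gt0 //; lra.
  apply: (prob_Deltabar_gt hG2 hxi); last first.
  + rewrite powE; rewrite qE in kN *; rewrite -{2}[rho](subKr 1).
    apply: (clique_rare_dense hG2 W0 W1 (b := true) _ kN); first by rewrite r0.
    by move=> y yI; rewrite Wt // subKr.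
  + by rewrite mulr_gt0 ?sqrtr_gt0 // mulr_gt0 ?sqrtr_gt0.
  rewrite -[(1 - rho) / (rho * q)]invf_div sqrtrV ?ltW // mulrACA div1r !mulfV ?mulr1 //.
    by rewrite gt_eqF // sqrtr_gt0.
  by rewrite gt_eqF // mulr_gt0 ?sqrtr_gt0.
- move=> h1 h2; have [r0 L2] : 0 < 1 - rho /\ 2 < ln q / ln (1 / (1 - rho)).
    by apply: two_lt_ln_ratio => //; lra.
  apply: (prob_Delta_gt hG2 hxi); first by rewrite -qE mulrAC.
  rewrite [1 * ln q ^+ 2]mul1r; rewrite qE in L2 *; apply: (clique_rare hG2 W0 W1 _ Wf) => //.
  by rewrite r0; lra.
- move=> c c1 c2 h1 h2.
  have [r0 r1 kN] := @dense_range R q rho c q12 c1 c2 h1 h2.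
  apply: (prob_Delta_gt hG2 hxi); last first.
    rewrite powE; rewrite qE in kN *.
    by apply: (clique_rare_dense hG2 W0 W1 (b := false) _ kN) => //; rewrite r0.
  rewrite -qE -[LHS]mulrA; congr (_ * _).
  have -> : (1 - rho) * q / rho = (1 - rho) / (rho * q) * q ^+ 2.
    by field; rewrite !gt_eqF.
  have A0 : 0 <= (1 - rho) / (rho * q) by rewrite divr_ge0 ?mulr_ge0 //; lra.
  rewrite (sqrtrM _ A0).
  by rewrite sqrtr_sqr (gtr0_norm q0) mulfK // gt_eqF.
Qed.
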